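(* The price of locality of the language At-most-one-selected (AMOS) is in $\Theta(n)$, that is, $PoL(n)=\dfrac{n\cdot s_\ell(n)}{s_m(n)}\in\Theta(n)$.
   Context: A network is a connected simple graph with no loops; $n$ denotes its number of nodes. The nodes are given distinct identifiers in a range that is polynomial in $n$, that is, identifiers on $O(\log n)$ bits. Nodes and edges may carry inputs; a distributed language is a set of graphs with such inputs. A local decision algorithm (verifier) with radius $t\ge 1$, where $t$ is constant with respect to $n$, is a local algorithm in which every node $v$ gathers all the information about its $t$-neighborhood (the structure of the graph, the identifiers, the inputs), together with the proofs given by a prover, and outputs accept or reject based on this information. The verifier is uniform: it does not know $n$. A non-deterministic scheme decides a language if, for every labeled graph, there exists a proof that makes every node accept if and only if the labeled graph belongs to the language. In a purely local proof, the prover provides every node with its own certificate (a node sees the certificates in its $t$-neighborhood); all certificates have the same size, which depends only on the language and on $n$, and the optimal size of a single certificate is denoted $s_\ell(n)$. In a mixed proof, the prover provides one global certificate that every node can access, as well as a local certificate for every node; its size is the sum of the size of the global certificate and the size of the concatenation of the local certificates (that is, $n f(n)+g(n)$ for local certificates of $f(n)$ bits each and a global certificate of $g(n)$ bits), and the optimal such size is denoted $s_m(n)$. The price of locality of a language is $PoL(n)=n\cdot s_\ell(n)/s_m(n)$. AMOS: the nodes are given binary inputs, a node is selected if its input is 1, and the labeled graphs in the language are those in which at most one node has input 1. *)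

(* Defs.v *)
From HB Require Import structures.
From mathcomp Require Export all_boot all_order all_algebra.
From mathcomp Require Export boolp classical_sets reals topology normedtype landau.
Export numFieldNormedType.Exports.

Set Implicit Arguments.
Unset Strict Implicit.
Unset Printing Implicit Defensive.

Import Order.TTheory GRing.Theory Num.Theory.

(** * Networks *)

Record labeled_graph (X : Type) := LabeledGraph {
  vertex :> finType;
  adj : rel vertex;
  input : vertex -> X;
  adj_sym : symmetric adj;
  adj_irrefl : irreflexive adj;
  adj_connected : forall u v, connect adj u v;
  vertex_gt0 : 0 < #|vertex| }.

(* Distinct identifiers in the polynomial range {0, ..., n ^ c - 1}. *)
Record id_assignment (X : Type) (c : nat) (G : labeled_graph X) := IdAssignment {
  id_of :> G -> nat;
  id_inj : injective id_of;
  id_bound : forall v, id_of v < #|G| ^ c }.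

(* Membership depends on the graph and the inputs, not on the identifiers. *)
Definition language (X : Type) := labeled_graph X -> Prop.

(** * Local verification *)

(* The vertices at distance at most t from v. *)
Definition node_ball (X : Type) (G : labeled_graph X) (t : nat) (v : G) : {set G} :=
  iter t (fun S => S :|: [set u | [exists w in S, adj w u]]) [set v]%SET.

(* What a node gathers from its t-neighborhood. Nodes are named by their
   identifiers, so that a view carries no other information about the vertices;
   an identifier absent from the neighborhood has input and certificate None. *)
Record view (X : Type) := View {
  view_center : nat;
  view_input : nat -> option X;
  view_cert : nat -> option (seq bool);
  view_adj : rel nat }.

(* The view of v: the subgraph induced by [node_ball t v], with the identifiers,
   the inputs and the local certificates lc of its nodes. *)
Definition view_of (X : Type) (c t : nat) (G : labeled_graph X)
    (id : id_assignment c G) (lc : G -> seq bool) (v : G) : view X :=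
  let node i := [pick u in node_ball t v | id u == i] in
  {| view_center := id v;
     view_input := fun i => omap (@input X G) (node i);
     view_cert := fun i => omap lc (node i);
     view_adj := fun i j =>
       if (node i, node j) is (Some u, Some w) then adj u w else false |}.

(* A verifier is one function of the view, hence uniform: n is not an argument. *)
Definition verifier (X : Type) := view X -> bool.

Definition mixed_verifier (X : Type) := seq bool -> verifier X.

Definition all_accept (X : Type) (c t : nat) (A : verifier X)
    (G : labeled_graph X) (id : id_assignment c G) (lc : G -> seq bool) : Prop :=
  forall v : G, A (view_of t id lc v).

Definition certs_of_size (X : Type) (G : labeled_graph X) (k : nat)
    (lc : G -> seq bool) : Prop :=
  forall v : G, size (lc v) = k.

(* [f n] is the size of the certificates that the honest prover uses on graphs
   with n nodes. Since the verifier does not know n, it cannot check that this is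
   the size of the certificates it is given: a graph outside the language has to
   be rejected whatever the common size k of the certificates. *)
Definition local_scheme (X : Type) (c t : nat) (L : language X)
    (A : verifier X) (f : nat -> nat) : Prop :=
  forall (G : labeled_graph X) (id : id_assignment c G),
    (L G -> exists lc : G -> seq bool,
       certs_of_size (f #|G|) lc /\ all_accept t A id lc) /\
    (~ L G -> forall (k : nat) (lc : G -> seq bool),
       certs_of_size k lc -> ~ all_accept t A id lc).

Definition mixed_scheme (X : Type) (c t : nat) (L : language X)
    (A : mixed_verifier X) (f g : nat -> nat) : Prop :=
  forall (G : labeled_graph X) (id : id_assignment c G),
    (L G -> exists (gc : seq bool) (lc : G -> seq bool),
       [/\ size gc = g #|G|, certs_of_size (f #|G|) lc
         & all_accept t (A gc) id lc]) /\
    (~ L G -> forall (gc : seq bool) (k : nat) (lc : G -> seq bool),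
       certs_of_size k lc -> ~ all_accept t (A gc) id lc).

(** * Optimal sizes and the price of locality *)

(* Least element of P; 0 if P is empty. *)
Definition least (P : set nat) : nat :=
  xget 0 [set m | P m /\ forall k, P k -> m <= k]%classic.

Definition s_local (X : Type) (c t : nat) (L : language X) (n : nat) : nat :=
  least [set s | exists (A : verifier X) (f : nat -> nat),
    local_scheme c t L A f /\ s = f n]%classic.

Definition s_mixed (X : Type) (c t : nat) (L : language X) (n : nat) : nat :=
  least [set s | exists (A : mixed_verifier X) (f g : nat -> nat),
    mixed_scheme c t L A f g /\ s = n * f n + g n]%classic.

(* R^o is R seen as a normed module over itself, as the Landau notations require. *)
Definition PoL (R : realType) (X : Type) (c t : nat) (L : language X)
    (n : nat) : R^o :=
  ((n * s_local c t L n)%:R / (s_mixed c t L n)%:R)%R.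

(** * At most one selected *)

Definition AMOS : language bool :=
  fun G => #|[set v : G | input v]%SET| <= 1.

(* Main.v *)
(** Both optimal sizes are of order log n. The identifier of the selected node,
    given globally, or given to every node and compared along the edges, is a
    proof of O(log n) bits. Conversely, take a cycle of constant length, with one
    vertex inflated to a clique so as to have n nodes, cut it into two halves
    A and B with the selected node in A, and take the identifiers of A in a block
    a and those of B in a block b. Colour the pair (a, b) by the global
    certificate and the local certificates outside the clique. If there are few
    colours, some a <> a' and b <> b' form a monochromatic square, and the cycle
    A_a B_b A_a' B_b', which has two selected nodes, is accepted: each of its
    views is a view of a cycle A_x B_y. *)

Require Import Defs.
From mathcomp Require Import zify.

Import GRing.Theory Num.Theory.

Set Implicit Arguments.
Unset Strict Implicit.
Unset Printing Implicit Defensive.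

(** * Balls, views and their transport along local isomorphisms *)

Lemma node_ball_center (X : Type) (G : labeled_graph X) (t : nat) (v : G) :
  v \in node_ball t v.
Proof.
rewrite /node_ball; elim: t => [|t IHt]; first by rewrite inE.
by rewrite iterS inE IHt.
Qed.

Lemma node_ball_adj (X : Type) (G : labeled_graph X) (t : nat) (u v : G) :
  0 < t -> adj v u -> u \in node_ball t v.
Proof.
case: t => // t _ vu; rewrite /node_ball iterS !inE; apply/orP; right.
by apply/exists_inP; exists v => //; apply: node_ball_center.
Qed.

Lemma pick_id (X : Type) (c : nat) (G : labeled_graph X)
    (id : id_assignment c G) (S : {set G}) (u : G) :
  u \in S -> [pick w in S | id w == id u] = Some u.
Proof.
move=> uS; case: pickP => [w /andP[_ /eqP/id_inj->] //|/(_ u)].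
by rewrite uS eqxx.
Qed.

Section Lift.
Variables (X : Type) (c t : nat) (G G' : labeled_graph X).
Variables (id : id_assignment c G) (id' : id_assignment c G').
Variables (lc : G -> seq bool) (lc' : G' -> seq bool).
Variables (h : G -> G') (q : G -> nat) (v : G).
Hypothesis h_id : forall u, id' (h u) = id u.
Hypothesis h_input : forall u, input (h u) = input u.
Hypothesis q_adj : forall u w, adj u w -> q u <= (q w).+1.
Hypothesis h_cert : forall u, 0 < q u -> lc' (h u) = lc u.
Hypothesis h_adj : forall u w, 0 < q u -> adj (h u) (h w) = adj u w.
Hypothesis h_nbr :
  forall u w', 0 < q u -> adj (h u) w' -> exists w, w' = h w.
Hypothesis t_lt_q : t < q v.

Let node_ball_depth k u : u \in node_ball k v -> q v <= q u + k.
Proof.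
elim: k u => [|k IHk] u; first by rewrite inE => /eqP->; rewrite addn0.
rewrite /node_ball iterS !inE => /orP[/IHk|/exists_inP[w /IHk]].
  by move/leq_trans; apply; rewrite leq_add2l.
by move=> le_qw /q_adj qw; apply: leq_trans le_qw _; rewrite addnS -addSn leq_add2r.
Qed.

Let node_ball_pos k u : k <= t -> u \in node_ball k v -> 0 < q u.
Proof.
move=> le_kt /node_ball_depth; case: (q u) => // /leq_trans/(_ le_kt).
by rewrite leqNgt t_lt_q.
Qed.

(** Depth stays positive within distance [t] of [v]; there [h] preserves adjacency and [h_nbr] keeps
    every neighbour inside the image, so the balls correspond layer by layer. *)
Let node_ball_lift k : k <= t -> node_ball k (h v) = h @: node_ball k v.
Proof.
elim: k => [|k IHk] lt_kt; first by rewrite /node_ball /= imset_set1.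
rewrite /node_ball !iterS -!/(node_ball _ _) IHk 1?ltnW //.
apply/setP => u'; rewrite !inE; apply/orP/imsetP.
  case=> [/imsetP[u uB ->]|/exists_inP[_ /imsetP[u uB ->] uu']].
    by exists u; rewrite ?inE ?uB.
  have qu := node_ball_pos (ltnW lt_kt) uB.
  have [w def_w] := h_nbr qu uu'; rewrite def_w h_adj // in uu' *.
  by exists w; rewrite // !inE; apply/orP; right; apply/exists_inP; exists u.
case=> u; rewrite !inE => /orP[uB ->|/exists_inP[w wB wu] ->].
  by left; apply: imset_f.
right; apply/exists_inP; exists (h w); first exact: imset_f.
by rewrite h_adj // (node_ball_pos (ltnW lt_kt) wB).
Qed.

(* [q] is a depth in the region where [h] is a local isomorphism: a vertex of
   depth greater than [t] does not see the boundary of this region. *)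
Lemma view_of_lift : view_of t id' lc' (h v) = view_of t id lc v.
Proof.
pose node i := [pick u in node_ball t v | id u == i].
have node_lift i :
  [pick u in node_ball t (h v) | id' u == i] = omap h (node i).
  rewrite /node node_ball_lift //; case: (pickP (fun u => _ && (id u == i))).
    move=> u /andP[uB /eqP <-] /=; rewrite -h_id pick_id //; exact: imset_f.
  move=> noi; case: pickP => // _ /andP[/imsetP[u uB ->]].
  by rewrite h_id => ui; have:= noi u; rewrite uB ui.
have nodeP i u : node i = Some u -> 0 < q u.
  rewrite /node; case: pickP => // w /andP[wB _] [<-].
  exact: node_ball_pos wB.
rewrite /view_of; congr View => //=.
- apply/funext => i; rewrite node_lift -/(node i).
  by case: (node i) => //= u; rewrite h_input.
- apply/funext => i; rewrite node_lift -/(node i).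
  by case def_u: (node i) => [u|] //=; rewrite h_cert // (nodeP i).
- apply/funext => i; apply/funext => j; rewrite !node_lift -!/(node _).
  case def_u: (node i) => [u|] //; case: (node j) => [w|] //=.
  by rewrite h_adj // (nodeP i).
Qed.

End Lift.

(** * The cycle with an inflated vertex and its double cover *)

Section TwistedCycle.
Variables (t n : nat).

(** With [2 * (t + 1)] positions in a half, the distances of a position to the two ends of its half
    add up to [2 * t + 1], so one of them exceeds [t]. *)
Definition half_cycle := t.+1.*2.

(** All surplus vertices are placed at [half_cycle], the first position of the second half: this is
    the clique. *)
Definition pos (u : 'I_n) : nat := if u < half_cycle.*2 then val u else half_cycle.

Definition seam (u w : 'I_n) : bool :=
  (pos u == 0) && (pos w == half_cycle.*2.-1) ||
  (pos w == 0) && (pos u == half_cycle.*2.-1).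

Lemma pos_lt (u : 'I_n) : pos u < half_cycle.*2.
Proof. by rewrite /pos; case: ifP => // _; rewrite /half_cycle; lia. Qed.

Lemma pos0 (u : 'I_n) : pos u = 0 -> u = 0 :> nat.
Proof. by rewrite /pos /half_cycle; case: ifP => //; lia. Qed.

Lemma pos_small (u : 'I_n) : pos u != half_cycle -> u < half_cycle.*2.
Proof. by rewrite /pos; case: ifP => // _; rewrite eqxx. Qed.

Variables (S : finType) (twist : S -> S).
Hypothesis twistK : involutive twist.
Hypothesis twist_trans : forall s s', s' = s \/ s' = twist s.
Hypothesis S_gt0 : 0 < #|S|.
Hypothesis le_cycle_n : half_cycle.*2 <= n.

Lemma pos_onto (i : nat) : i < half_cycle.*2 -> exists u : 'I_n, pos u = i.
Proof.
move=> lt_i; exists (Ordinal (leq_trans lt_i le_cycle_n)).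
by rewrite /pos /= lt_i.
Qed.

(** Crossing the seam applies [twist]: on [unit] this closes the cycle, and [negb] on [bool] joins
    two sheets into one cycle of twice the length. Distinct vertices of a sheet at the same position
    are adjacent, whence the clique. *)
Definition cycle_adj (x y : S * 'I_n) : bool :=
  (x != y) &&
  (if seam x.2 y.2 then y.1 == twist x.1
   else [&& y.1 == x.1, pos x.2 <= (pos y.2).+1 & pos y.2 <= (pos x.2).+1]).

Lemma cycle_adj_sym : symmetric cycle_adj.
Proof.
move=> x y; rewrite /cycle_adj eq_sym /seam orbC; congr (_ && _).
case: ifP => _; first by apply/eqP/eqP => ->; rewrite twistK.
by rewrite eq_sym; congr (_ && _); rewrite andbC.
Qed.

Lemma cycle_adj_irrefl : irreflexive cycle_adj.
Proof. by move=> x; rewrite /cycle_adj eqxx. Qed.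

(** Each sheet is walked down to position 0, from where the seam leads to the twisted sheet. *)
Lemma cycle_adj_connected x y : connect cycle_adj x y.
Proof.
have csym := sym_connect_sym cycle_adj_sym.
have [r pos_r] : exists u : 'I_n, pos u = 0.
  by apply: pos_onto; rewrite /half_cycle; lia.
have [m pos_m] : exists u : 'I_n, pos u = half_cycle.*2.-1.
  by apply: pos_onto; rewrite /half_cycle; lia.
have to_root s u : connect cycle_adj (s, u) (s, r).
  have [i] := ubnP (pos u); elim: i u => // i IHi u lt_ui.
  have [u0|u_gt0] := posnP (pos u).
    suff -> : u = r by [].
    by apply/val_inj; rewrite /= !pos0.
  have [|w pos_w] := pos_onto (i := (pos u).-1); first by have:= pos_lt u; lia.
  apply: connect_trans (IHi w _); last by lia.
  have [<- //|neq_uw] := eqVneq (s, u) (s, w).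
  apply: connect1; rewrite /cycle_adj neq_uw /= /seam eqxx.
  by have := pos_lt u; rewrite pos_w; case: ifP; rewrite /half_cycle; lia.
have to_twist s : connect cycle_adj (s, r) (twist s, r).
  apply: connect_trans (to_root _ m); apply: connect1.
  rewrite /cycle_adj /= /seam pos_r pos_m !eqxx /= andbT.
  apply/eqP => -[_ rm]; move: pos_m; rewrite -rm pos_r /half_cycle; lia.
case: x y => [s u] [s' w]; apply: connect_trans (to_root s u) _.
rewrite csym; apply: connect_trans (to_root s' w) _; rewrite csym.
by have [->|->] := twist_trans s s'.
Qed.

Lemma cycle_card_gt0 : 0 < #|{: S * 'I_n}|.
Proof.
by rewrite card_prod card_ord muln_gt0 S_gt0; move: le_cycle_n; rewrite /half_cycle; lia.
Qed.

(* The cycle of length [2 * half_cycle] of which one vertex is replaced by a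
   clique, so as to have [n] vertices, or the double cover of this graph. *)
Definition cycle_graph : labeled_graph bool :=
  {| vertex := (S * 'I_n)%type; adj := cycle_adj;
     input := fun x => val x.2 == 0;
     adj_sym := cycle_adj_sym; adj_irrefl := cycle_adj_irrefl;
     adj_connected := cycle_adj_connected; vertex_gt0 := cycle_card_gt0 |}.

(** Each sheet has one selected vertex, so the single cycle is in the language and the double cover
    is not. *)
Lemma card_selected : #|[set x : cycle_graph | input x]%SET| = #|S|.
Proof.
have [r pos_r] : exists u : 'I_n, pos u = 0.
  by apply: pos_onto; rewrite /half_cycle; lia.
have inj_o : injective (fun s : S => (s, r)) by move=> s s' [].
rewrite -(card_imset _ inj_o); apply: eq_card => -[s u]; rewrite !inE /=.
apply/eqP/imsetP => [u0|[s' _ [_ ->]]]; last exact: pos0.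
by exists s => //; congr (_, _); apply/val_inj; rewrite /= u0 pos0.
Qed.

Variables (c : nat) (alpha beta : S -> nat).
Hypothesis c_gt1 : 1 < c.
Hypotheses (alpha_inj : injective alpha) (beta_inj : injective beta).
Hypotheses (alpha_lt : forall s, alpha s < n) (beta_lt : forall s, beta s < n).

(** Two digits in base [n]: the low one recovers the vertex, the high one the sheet. Identifiers are
    below [n ^ 2], in range since [1 < c]. *)
Definition cycle_id_of (x : cycle_graph) : nat :=
  (if pos x.2 < half_cycle then alpha x.1 else beta x.1) * n + x.2.

Lemma cycle_id_inj : injective cycle_id_of.
Proof.
move=> [s u] [s' w]; rewrite /cycle_id_of /= => e.
have n_gt0 := leq_ltn_trans (leq0n _) (ltn_ord u).
have uw : u = w.
  apply/val_inj; have /(congr1 (modn^~ n)) := e.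
  by rewrite !modnMDl !modn_small.
move/eqP: e; rewrite uw eqn_add2r; case: ifP => _; rewrite eqn_pmul2r // => /eqP.
  by move/alpha_inj->.
by move/beta_inj->.
Qed.

Lemma cycle_id_bound x : cycle_id_of x < #|cycle_graph| ^ c.
Proof.
have [s u] := x; rewrite /cycle_id_of /=.
have n_gt0 := leq_ltn_trans (leq0n _) (ltn_ord u).
have := alpha_lt s; have := beta_lt s; set k := if _ then _ else _.
move=> b_lt a_lt; have k_lt : k < n by rewrite /k; case: ifP.
apply: (@leq_trans (n ^ c)); last first.
  by rewrite leq_exp2r ?(ltnW c_gt1) // card_prod card_ord leq_pmull.
apply: leq_trans (leq_pexp2l n_gt0 c_gt1).
apply: (@leq_trans (k.+1 * n)); last by rewrite leq_mul2r k_lt orbT.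
by rewrite mulSn addnC ltn_add2r ltn_ord.
Qed.

Definition cycle_id : id_assignment c cycle_graph :=
  {| id_inj := cycle_id_inj; id_bound := cycle_id_bound |}.

End TwistedCycle.

(** * Splicing proofs of single cycles into a proof of the double cover *)

Section Splice.
Variables (t n c : nat).
Hypotheses (c_gt1 : 1 < c) (le_cycle_n : (half_cycle t).*2 <= n).

Definition single_cycle : labeled_graph bool :=
  cycle_graph (S := unit) (twist := id) (fun=> erefl)
    (fun 'tt 'tt => or_introl erefl) (eq_leq (esym card_unit)) le_cycle_n.

Lemma bool_negb (s s' : bool) : s' = s \/ s' = ~~ s.
Proof. by case: s s' => [] [] ; [left|right|right|left]. Qed.

Definition double_cycle : labeled_graph bool :=
  cycle_graph negbK bool_negb (ltnW (eq_leq (esym card_bool))) le_cycle_n.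

Definition single_id (a b : 'I_n) : id_assignment c single_cycle :=
  cycle_id (alpha := fun=> val a) (beta := fun=> val b) _ _ _ le_cycle_n c_gt1
    (fun 'tt 'tt _ => erefl) (fun 'tt 'tt _ => erefl)
    (fun=> ltn_ord a) (fun=> ltn_ord b).

Variables (alpha beta : bool -> 'I_n).
Hypotheses (alpha_inj : injective alpha) (beta_inj : injective beta).

Definition double_id : id_assignment c double_cycle :=
  cycle_id (alpha := fun s => val (alpha s)) (beta := fun s => val (beta s))
    _ _ _ le_cycle_n c_gt1
    (inj_comp val_inj alpha_inj) (inj_comp val_inj beta_inj)
    (fun s => ltn_ord (alpha s)) (fun s => ltn_ord (beta s)).

Variable lc : bool -> bool -> single_cycle -> seq bool.
Hypothesis lc_agree : forall i j i' j' (x : single_cycle),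
  pos t x.2 != half_cycle t -> lc i j x = lc i' j' x.

(** The pair [(s, s)] matters only at the clique of sheet [s], which lies between the halves with
    blocks [alpha s] and [beta s]. *)
Definition splice_cert (x : double_cycle) : seq bool := lc x.1 x.1 (tt, x.2).

(* Away from the two seams, the sheet [s] of the double cover is the single cycle
   with blocks [alpha s] and [beta s]. Near a seam, the half of a sheet before the
   seam and the half of the other sheet after it are a single cycle seen far from
   the boundary between its halves, hence far from the clique, whose certificates
   need not agree. *)
Lemma view_splice (x : double_cycle) : exists i j,
  view_of t double_id splice_cert x
  = view_of t (single_id (alpha i) (beta j)) (lc i j) (tt, x.2).
Proof.
case: x => s v /=.
pose far_seam (x : single_cycle) :=
  minn (pos t x.2) ((half_cycle t).*2.-1 - pos t x.2).
pose far_half (x : single_cycle) :=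
  if pos t x.2 < half_cycle t then (half_cycle t).-1 - pos t x.2
  else pos t x.2 - half_cycle t.
have no_seam u w : 0 < far_seam (tt, u) -> seam t u w = false.
  rewrite /far_seam /seam /=; lia.
have [lt_t|le_t] := ltnP t (far_seam (tt, v)).
  exists s, s; pose h (x : single_cycle) : double_cycle := (s, x.2).
  apply: (view_of_lift (h := h) _ _ _ _ _ _ lt_t).
  - by [].
  - by [].
  - move=> [[] u] [[] w]; rewrite /adj /= /cycle_adj /= /seam /far_seam /=.
    have := pos_lt t u; have := pos_lt t w; case: ifP; rewrite /half_cycle; lia.
  - by case=> [[] u].
  - move=> [[] u] [[] w] qu.
    by rewrite /adj /= /cycle_adj /= !xpair_eqE !eqxx /= no_seam.
  - move=> [[] u] [s' w] qu; rewrite /adj /= /cycle_adj /= no_seam //.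
    by case/and3P=> _ /eqP-> _; exists (tt, w).
(* The seam joins the second half of a sheet to the first half of the other; [s'] is the sheet of
   the first half that touches the seam near [v]. *)
pose s' := if pos t v < half_cycle t then s else ~~ s.
exists s', (~~ s').
pose h (x : single_cycle) : double_cycle :=
  (if pos t x.2 < half_cycle t then s' else ~~ s', x.2).
have def_sv : (s, v) = h (tt, v).
  by rewrite /h /s' /=; case: (pos t v < _); rewrite ?negbK.
have lt_t : t < far_half (tt, v).
  move: le_t; rewrite /far_seam /far_half /=; have := pos_lt t v.
  rewrite /half_cycle; case: ifP; lia.
rewrite def_sv; apply: (view_of_lift (h := h) _ _ _ _ _ _ lt_t).
- move=> [[] u]; rewrite /= /cycle_id_of /h /=.
  by case: (pos t u < _).
- by [].
- move=> [[] u] [[] w]; rewrite /adj /= /cycle_adj /= /seam /far_half /=.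
  have := pos_lt t u; have := pos_lt t w.
  by case: ifP; case: ifP; case: ifP; rewrite /half_cycle; lia.
- move=> [[] u] qu; apply: lc_agree; apply/eqP => /= pos_u.
  by move: qu; rewrite /far_half /= pos_u ltnn subnn.
- move=> [[] u] [[] w]; rewrite /adj /= /cycle_adj /= !xpair_eqE /far_half /=.
  move=> qu; have [<-|ne_uw] := eqVneq u w; first by rewrite !eqxx.
  rewrite !andbF /=; have lt_u := pos_lt t u; have lt_w := pos_lt t w.
  move: qu lt_u lt_w; rewrite /seam /half_cycle.
  by case: (s'); case: ifP; case: ifP; case: ifP => /=; rewrite ?eqxx; lia.
- move=> [[] u] [s1 w]; rewrite /adj /= /cycle_adj /= /far_half /=.
  move=> qu /andP[_ adj_uw]; exists (tt, w); congr (_, _).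
  have lt_u := pos_lt t u; have lt_w := pos_lt t w.
  move: qu lt_u lt_w adj_uw; rewrite /seam /half_cycle.
  by case: (s'); case: s1; case: ifP; case: ifP; case: ifP => /=; rewrite ?eqxx; lia.
Qed.

End Splice.

(** * Lower bound by the pigeonhole principle *)

(** Two pigeonholes: each row repeats a colour among its first [#|T| + 1] columns; then two rows
    share both the pair of columns and the colour, there being [(#|T| + 1) ^ 2 * #|T|] such data. *)
Lemma monochromatic_square (T : finType) (n : nat) (col : 'I_n -> 'I_n -> T) :
  #|T|.+1 ^ 2 * #|T| < n ->
  exists alpha beta : bool -> 'I_n, [/\ injective alpha, injective beta
    & forall i j i' j', col (alpha i) (beta j) = col (alpha i') (beta j')].
Proof.
move=> lt_n; have le_n : #|T|.+1 <= n.
  have [T0|T_gt0] := posnP #|T|; last by move: lt_n; rewrite expnS expn1; nia.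
  suff : 0 < n by rewrite T0.
  exact: leq_ltn_trans lt_n.
have row_col a : exists p : 'I_#|T|.+1 * 'I_#|T|.+1, p.1 != p.2 /\
    col a (widen_ord le_n p.1) = col a (widen_ord le_n p.2).
  apply: contrapT => no_p.
  suff /leq_card : injective (fun b => col a (widen_ord le_n b)).
    by rewrite card_ord ltnn.
  move=> b b' eq_b; apply/eqP/negPn/negP => neq_b.
  by apply: no_p; exists (b, b').
have [p p_col] := choice row_col.
have [a [a' [neq_a eq_p eq_col]]] : exists a a', [/\ a != a', p a = p a' &
    col a (widen_ord le_n (p a).1) = col a' (widen_ord le_n (p a').1)].
  apply: contrapT => no_a.
  suff /leq_card : injective (fun a => (p a, col a (widen_ord le_n (p a).1))).
    by rewrite !card_prod !card_ord leqNgt mulnn lt_n.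
  move=> a a' [eq_p eq_col]; apply/eqP/negPn/negP => neq_a.
  by apply: no_a; exists a, a'.
pose alpha i := if i then a else a'.
pose beta j := widen_ord le_n (if j then (p a).1 else (p a).2).
have [neq_p col_p] := p_col a; have [_ col_p'] := p_col a'.
exists alpha, beta; split.
- by case=> [] []; rewrite /alpha // => e; rewrite e eqxx in neq_a.
- by case=> [] [] /(congr1 val) /= /val_inj // e; rewrite e eqxx in neq_p.
suff eq_c i j : col (alpha i) (beta j) = col a (widen_ord le_n (p a).1).
  by move=> i j i' j'; rewrite !eq_c.
rewrite -eq_p in col_p' eq_col; rewrite /alpha /beta.
by case: i; case: j => //; rewrite -?col_p -?col_p' -eq_col.
Qed.

Lemma mixed_scheme_AMOS_size (c t n : nat) (A : mixed_verifier bool)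
    (f g : nat -> nat) :
  1 < c -> (half_cycle t).*2 <= n -> mixed_scheme c t AMOS A f g ->
  n <= (2 ^ (g n + f n * (half_cycle t).*2)).+1 ^ 3.
Proof.
move=> c_gt1 le_cycle_n schemeA; set m := (half_cycle t).*2.
pose G1 := single_cycle le_cycle_n; pose G2 := double_cycle le_cycle_n.
have card_G1 : #|G1| = n by rewrite card_prod card_unit card_ord mul1n.
have yes : AMOS G1 by rewrite /AMOS card_selected card_unit.
have no : ~ AMOS G2 by rewrite /AMOS card_selected card_bool.
have honest (ab : 'I_n * 'I_n) : exists gl : seq bool * (G1 -> seq bool),
    [/\ size gl.1 = g n, certs_of_size (f n) gl.2
      & all_accept t (A gl.1) (single_id c_gt1 le_cycle_n ab.1 ab.2) gl.2].
  have [/(_ yes)[gc [lc]]] := schemeA G1 (single_id c_gt1 le_cycle_n ab.1 ab.2).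
  by rewrite card_G1 => ? _; exists (gc, lc).
have [gl glP] := choice honest.
pose T : finType := ((g n).-tuple bool * {ffun 'I_m -> (f n).-tuple bool})%type.
(* Only the first [m] vertices are recorded, so the number of colours does not grow with the clique.
   [insubd] merely casts: honest certificates have exactly these sizes. *)
pose col a b : T := (insubd (nseq_tuple (g n) false) (gl (a, b)).1,
  [ffun i => insubd (nseq_tuple (f n) false)
    ((gl (a, b)).2 (tt, widen_ord le_cycle_n i))]).
have card_T : #|T| = 2 ^ (g n + f n * m).
  by rewrite card_prod card_ffun !card_tuple card_bool card_ord -expnM expnD.
rewrite leqNgt; apply/negP => lt_n.
have [|alpha [beta [alpha_inj beta_inj eq_col]]] :=
    @monochromatic_square _ _ col.
  apply: leq_ltn_trans lt_n; rewrite card_T (expnSr _ 2).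
  by rewrite leq_mul2l leqnSn orbT.
have insubdE k (s : seq bool) :
    size s = k -> val (insubd (nseq_tuple k false) s) = s.
  by move=> sk; rewrite val_insubd sk eqxx.
have eq_gc i j : (gl (alpha i, beta j)).1 = (gl (alpha true, beta true)).1.
  have /(congr1 (fun x : T => val x.1)) := eq_col i j true true.
  by rewrite /= !insubdE //; case: (glP (alpha i, beta j)); case: (glP (alpha true, beta true)).
have eq_lc i j i' j' (x : G1) : pos t x.2 != half_cycle t ->
    (gl (alpha i, beta j)).2 x = (gl (alpha i', beta j')).2 x.
  case: x => [[] u] /= /pos_small lt_u.
  have := congr1 (fun x : T => val (x.2 (Ordinal lt_u))) (eq_col i j i' j').
  rewrite /= !ffunE !insubdE; last first.
  - by have [_ + _] := glP (alpha i, beta j); apply.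
  - by have [_ + _] := glP (alpha i', beta j'); apply.
  by have -> : widen_ord le_cycle_n (Ordinal lt_u) = u by apply/val_inj.
pose lc i j := (gl (alpha i, beta j)).2.
(* The double cover has [2 * n] nodes but certificates of size [f n]; soundness applies because it
   covers every common size. *)
have [_ /(_ no (gl (alpha true, beta true)).1 (f n) (splice_cert lc))] :=
  schemeA G2 (double_id c_gt1 le_cycle_n alpha_inj beta_inj).
apply=> [[s u]|x]; first by have [_ + _] := glP (alpha s, beta s); apply.
have [i [j ->]] := view_splice c_gt1 alpha_inj beta_inj eq_lc x.
by rewrite -(eq_gc i j); case: (glP (alpha i, beta j)).
Qed.

(** * Explicit schemes with proofs of logarithmic size *)

Definition nat_of_bits (s : seq bool) : nat :=
  foldr (fun (b : bool) k => b + k.*2) 0 s.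

Lemma nat_of_bits_onto (k i : nat) :
  i < 2 ^ k -> exists s, size s = k /\ nat_of_bits s = i.
Proof.
elim: k i => [|k IHk] i lt_i; first by exists [::]; move: lt_i; case: i.
have [|s [size_s val_s]] := IHk i./2; first by move: lt_i; rewrite expnS; lia.
by exists (odd i :: s); rewrite /= size_s val_s odd_double_half.
Qed.

(** Since [n < 2 ^ (trunc_log 2 n).+1], this many bits suffice for any identifier below [n ^ c]. *)
Definition id_bits (c n : nat) : nat := c * (trunc_log 2 n).+1.

Lemma id_bits_bound (c n : nat) : n ^ c <= 2 ^ id_bits c n.
Proof.
rewrite /id_bits mulnC expnM; case: c => [//|c].
by rewrite leq_exp2r //; apply/ltnW/trunc_log_ltn.
Qed.

Definition selected_is : mixed_verifier bool := fun gc w =>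
  (view_input w (view_center w) == Some true)
    ==> (nat_of_bits gc == view_center w).

(** Simulates a global certificate: all certificates in view must equal the node's own one. *)
Definition agreed_selected_is : verifier bool := fun w =>
  let own := view_cert w (view_center w) in
  `[< forall i l, view_cert w i = Some l -> own = Some l >]
    && selected_is (odflt [::] own) w.

Section Schemes.
Variables (c t : nat) (G : labeled_graph bool) (id : id_assignment c G).

Lemma view_of_input lc (u v : G) : u \in node_ball t v ->
  view_input (view_of t id lc v) (id u) = Some (input u).
Proof. by move=> uB; rewrite /= pick_id. Qed.

Lemma view_of_cert lc (u v : G) : u \in node_ball t v ->
  view_cert (view_of t id lc v) (id u) = Some (lc u).
Proof. by move=> uB; rewrite /= pick_id. Qed.

Lemma selected_isE gc lc (v : G) :
  selected_is gc (view_of t id lc v) = (input v ==> (nat_of_bits gc == id v)).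
Proof.
rewrite /selected_is [view_center _]/= view_of_input ?node_ball_center //.
by case: (input v).
Qed.

Lemma AMOS_complete : AMOS G ->
  exists gc, size gc = id_bits c #|G| /\
    forall lc v, selected_is gc (view_of t id lc v).
Proof.
move=> /card_le1_eqP le1.
have [i lt_i id_i] : exists2 i, i < 2 ^ id_bits c #|G| &
    forall v : G, input v -> i = id v.
  have [v v_sel|no_sel] := pickP (@input _ G); last first.
    (* With no selected node, no node tests the number, and 0 will do. *)
    by exists 0 => [|v]; rewrite ?expn_gt0 ?no_sel.
  exists (id v) => [|u u_sel].
    exact: leq_trans (id_bound id v) (id_bits_bound _ _).
  by congr (id _); apply: le1; rewrite inE.
have [gc [size_gc val_gc]] := nat_of_bits_onto lt_i.
exists gc; split=> // lc v; rewrite selected_isE val_gc.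
by apply/implyP => /id_i->.
Qed.

Lemma AMOS_sound gc :
  (forall v : G, input v -> nat_of_bits gc = id v) -> AMOS G.
Proof.
move=> id_gc; apply/card_le1_eqP => u v; rewrite !inE => u_sel v_sel.
by apply: (id_inj (i := id)); rewrite -!id_gc.
Qed.

End Schemes.

Lemma mixed_scheme_AMOS (c t : nat) :
  mixed_scheme c t AMOS selected_is (fun=> 0) (id_bits c).
Proof.
move=> G id; split=> [/(AMOS_complete t id)[gc [size_gc acc]]|notL gc k lc _ acc].
  by exists gc, (fun=> [::]); split=> // v; apply: acc.
apply: notL; apply: (AMOS_sound (id := id) (gc := gc)) => v v_sel; apply/eqP.
by have := acc v; rewrite selected_isE v_sel.
Qed.

Lemma local_scheme_AMOS (c t : nat) : 0 < t ->
  local_scheme c t AMOS agreed_selected_is (id_bits c).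
Proof.
move=> t_gt0 G id; split=> [/(AMOS_complete t id)[gc [size_gc acc]]|notL k lc _ acc].
  exists (fun=> gc); split=> // v; rewrite /agreed_selected_is.
  rewrite [view_center _]/= view_of_cert ?node_ball_center // acc andbT.
  by apply/asboolP => i l /=; case: pickP => //= ? _ [->].
(* As [0 < t], neighbours see each other's certificates; equality then propagates along a path. *)
have agree u v : lc u = lc v.
  have := adj_connected u v => /connectP[p]; elim: p u => [|w p IHp] u /=.
    by move=> _ ->.
  move=> /andP[uw /IHp{}IHp] /IHp <-.
  have /andP[/asboolP/(_ (id w) (lc w)) + _] := acc u.
  rewrite view_of_cert ?node_ball_adj // [view_center _]/=.
  by rewrite view_of_cert ?node_ball_center // => /(_ erefl)[].
have /card_gt0P[v0 _] := vertex_gt0 G.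
apply: notL; apply: (AMOS_sound (id := id) (gc := lc v0)) => v v_sel; apply/eqP.
have /andP[_] := acc v; rewrite [view_center _]/=.
by rewrite view_of_cert ?node_ball_center //= selected_isE v_sel (agree v v0).
Qed.

(** * Optimal sizes and their quotient *)

(** Taking the global certificate empty lets the lower bound for mixed schemes apply to local
    ones. *)
Lemma local_to_mixed_scheme (X : Type) (c t : nat) (L : language X)
    (A : verifier X) (f : nat -> nat) :
  local_scheme c t L A f -> mixed_scheme c t L (fun=> A) f (fun=> 0).
Proof.
move=> schemeA G id; have [yes no] := schemeA G id; split=> [/yes[lc []]|/no notL].
  by exists [::], lc.
by move=> _.
Qed.

Lemma leastP (P : set nat) (k : nat) : P k -> P (least P) /\ least P <= k.
Proof.
move=> Pk; rewrite /least.
set Q := (X in xget 0 X).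
have /(xgetPex 0)[Pm min_m] : exists m, Q m.
  have exP : exists m, `[< P m >] by exists k; apply/asboolP.
  case: (ex_minnP exP) => m /asboolP Pm min_m.
  by exists m; split=> // j /asboolP/min_m.
by split=> //; apply: min_m.
Qed.

Section AMOSSizes.
Variables (c t n : nat).
Hypotheses (c_gt1 : 1 < c) (le_cycle_n : (half_cycle t).*2 <= n).

(** Logarithm of the cubic bound, using [2 ^ e + 1 <= 2 ^ (e + 1)]. *)
Lemma mixed_scheme_AMOS_log (A : mixed_verifier bool) (f g : nat -> nat) :
  mixed_scheme c t AMOS A f g ->
  trunc_log 2 n <= 3 * (g n + f n * (half_cycle t).*2).+1.
Proof.
move/(mixed_scheme_AMOS_size c_gt1 le_cycle_n); set e := g n + _ => le_n.
have n_gt0 : 0 < n by move: le_cycle_n; rewrite /half_cycle; lia.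
rewrite -(leq_exp2l (m := 2)) //; apply: leq_trans (trunc_logP _ n_gt0) _ => //.
apply: leq_trans le_n _; rewrite mulnC expnM leq_exp2r // expnS mul2n -addnn.
by rewrite -add1n leq_add2r expn_gt0.
Qed.

Lemma s_local_AMOS_bounds : 0 < t ->
  trunc_log 2 n <= 3 * (s_local c t AMOS n * (half_cycle t).*2).+1 /\
  s_local c t AMOS n <= id_bits c n.
Proof.
move=> t_gt0; have [|] := @leastP [set s | exists (A : verifier bool) f,
    local_scheme c t AMOS A f /\ s = f n]%classic (id_bits c n).
  by exists agreed_selected_is, (id_bits c); split=> //; apply: local_scheme_AMOS.
rewrite -/(s_local c t AMOS n) => -[A [f [schemeA ->]]] le_f; split=> //.
exact: mixed_scheme_AMOS_log (local_to_mixed_scheme schemeA).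
Qed.

Lemma s_mixed_AMOS_bounds :
  trunc_log 2 n <= 3 * (s_mixed c t AMOS n).+1 /\
  s_mixed c t AMOS n <= id_bits c n.
Proof.
have [|] := @leastP [set s | exists (A : mixed_verifier bool) f g,
    mixed_scheme c t AMOS A f g /\ s = n * f n + g n]%classic (id_bits c n).
  exists selected_is, (fun=> 0), (id_bits c); split; last by rewrite muln0.
  exact: mixed_scheme_AMOS.
rewrite -/(s_mixed c t AMOS n) => -[A [f [g [schemeA ->]]]] le_fg; split=> //.
apply: leq_trans (mixed_scheme_AMOS_log schemeA) _.
(* As the cycle length is at most [n], the exponent is at most the mixed size [n * f n + g n]. *)
by rewrite leq_mul2l ltnS addnC leq_add2r mulnC leq_mul2r le_cycle_n orbT.
Qed.

End AMOSSizes.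

Theorem corollary3 (R : realType) (c t : nat) (hc : 1 < c) (ht : 1 <= t) :
  PoL R c t AMOS \is 'Theta_(\oo%classic)(fun n : nat => (n%:R)%R : R^o).
Proof.
set m := (half_cycle t).*2.
have m_gt0 : 0 < m by rewrite /m /half_cycle; lia.
have cm_gt0 : 0 < 12 * c * m by rewrite !muln_gt0 m_gt0; lia.
(* The constants restate [le_s] and [le_l] below; [m] depends on [t] only. *)
apply/asboolP; exists ((12 * c * m)%:R^-1, (12 * c)%:R)%R.
  by rewrite /= invr_gt0 !ltr0n cm_gt0; lia.
(* [64 = 2 ^ 6] gives [6 <= k], so [k <= 3 * s.+1] forces [0 < s], and the factor 12 absorbs the
   additive constants. *)
exists (maxn m 64) => // n /=; rewrite geq_max => /andP[le_mn le_64n].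
have le_6 : 6 <= trunc_log 2 n by apply: trunc_log_max.
have [log_l l_log] := s_local_AMOS_bounds hc le_mn ht.
have [log_m m_log] := s_mixed_AMOS_bounds hc le_mn.
rewrite /PoL; move: log_l l_log log_m m_log; rewrite -/m.
set l := s_local _ _ _ _; set s := s_mixed _ _ _ _; set k := trunc_log _ _.
rewrite /id_bits -/k => log_l l_log log_m m_log.
have s_gt0 : 0 < s by lia.
have le_s : s <= 12 * c * m * l.
  apply: leq_trans m_log _; rewrite [12 * c]mulnC -!mulnA leq_mul2l.
  by rewrite [m * l]mulnC; apply/orP; right; lia.
have le_l : l <= 12 * c * s.
  apply: leq_trans l_log _; rewrite [12 * c]mulnC -!mulnA leq_mul2l.
  by apply/orP; right; lia.
rewrite !ger0_norm ?divr_ge0 ?ler0n //; split.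
  rewrite ler_pdivlMr ?ltr0n // -mulrA ler_pdivrMl ?ltr0n // -!natrM ler_nat.
  by rewrite mulnCA leq_mul2l le_s orbT.
rewrite ler_pdivrMr ?ltr0n // -!natrM ler_nat.
by rewrite mulnAC [n * l]mulnC leq_mul2r le_l orbT.
Qed.
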